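(* Let $a_1,\dots,a_n$ be nonnegative constants and let $X_1,\dots,X_n$ be independent Rademacher variables (i.e. $\mathbb{P}\{X_i=-1\}=\mathbb{P}\{X_i=1\}=1/2$). If $Z=\sum_{i=1}^n a_iX_i$, then for any integer $q\ge2$, $$\|(Z)_+\|_q=\|(Z)_-\|_q\le\sqrt{2Kq}\,\sqrt{\sum_{i=1}^n a_i^2}$$ and $$\|Z\|_q\le2^{1/q}\sqrt{2Kq}\,\sqrt{\sum_{i=1}^na_i^2},$$ where $K=1/(e-\sqrt e)<0.935$.
   Context: $x_+=\max(x,0)$, $x_-=\max(-x,0)$, and $\|Y\|_q=(\mathbb{E}|Y|^q)^{1/q}$. *)

(* Defs.v *)
From HB Require Import structures.
From mathcomp Require Import all_boot all_order all_algebra.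
From mathcomp Require Import all_classical all_reals all_analysis.

Set Implicit Arguments.
Unset Strict Implicit.
Unset Printing Implicit Defensive.

Import Order.TTheory GRing.Theory Num.Theory.
Import numFieldNormedType.Exports.

Local Open Scope classical_set_scope.
Local Open Scope ring_scope.

Definition independent_RVs (d d' : measure_display) (T : measurableType d)
    (T' : measurableType d') (R : realType) (P : probability T R)
    (I : finType) (X : I -> {RV P >-> T'}) : Prop :=
  forall (J : {set I}) (A : I -> set T'), (forall i, measurable (A i)) ->
    P (\bigcap_(i in [set` J]) X i @^-1` A i) =
    (\prod_(i in J) P (X i @^-1` A i))%E.

Definition rademacher (d : measure_display) (T : measurableType d)
    (R : realType) (P : probability T R) (Y : {RV P >-> R}) : Prop :=
  P (Y @^-1` [set -1]) = (2^-1)%:E /\ P (Y @^-1` [set 1]) = (2^-1)%:E.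

Arguments independent_RVs {d d' T T' R} P {I} X.
Arguments rademacher {d T R} P Y.

(* Main.v *)
Require Import Defs.
From mathcomp Require Import all_boot all_order all_algebra.
From mathcomp Require Import all_classical all_reals all_analysis.
From mathcomp Require Import measurable_realfun.
From mathcomp Require Import ring lra.

Import Order.TTheory GRing.Theory Num.Theory.
Import numFieldNormedType.Exports.

Local Open Scope classical_set_scope.
Local Open Scope ring_scope.

(** With [S] the sum of the [a i ^+ 2], the stronger bound
    [||Z_+||_q <= sqrt (q S / e)] holds, by the exponential moment method.  It
    implies the stated one because [e - sqrt e <= e], so [e^-1 <= K <= 2 K].

    For every [l > 0], applying [1 + t <= expR t] to [t = l x / q - 1] gives
    [x_+ ^ q <= (q / (l e)) ^ q * expR (l x)] ([maxr0_exp_le]).  By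
    independence [E expR (l Z)] is the product of the [cosh (l a i)], and
    [cosh x <= expR (x ^ 2 / 2)] ([expR_sym_le]), so
    [E expR (l Z) <= expR (l ^ 2 S / 2)].  The choice [l = sqrt (q / S)]
    yields the bound ([sign_mean_pos_part_le]).  The negative part has the same
    moments because [Z] is symmetric, and [|Z| ^ q = Z_+ ^ q + Z_- ^ q]
    produces the factor [2 ^ (1 / q)] for the full norm.

    These computations take place on sign patterns: the joint law of the signs is
    uniform on the [2 ^ n] sign patterns, so every [L^q] norm of a function of
    [Z] is a finite average ([Lnorm_sign_sum]), in which independence becomes
    the expansion of a product of sums and symmetry becomes a reindexing. *)

(** * Exponential inequalities *)

Lemma leq_expn2_fact_double (k : nat) : (2 ^ k * k`! <= (k.*2)`!)%N.
Proof.
elim: k => // k IH; rewrite doubleS factS factS factS expnS.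
rewrite mulnACA mul2n -doubleS leq_pmul2l//.
by rewrite (leq_trans IH)// leq_pmull.
Qed.

Lemma series_exp_coeff_le {R : realType} {x : R} (N : nat) : 0 <= x ->
  series (exp_coeff x) N <= expR x.
Proof.
move=> x0; apply: nondecreasing_cvgn_le; last exact: is_cvg_series_exp_coeff.
apply/nondecreasing_seqP => k; rewrite seriesSr lerDl.
exact: exp_coeff_ge0.
Qed.

(** The Rademacher variable is subgaussian with variance proxy 1: twice [cosh]
    against twice a Gaussian.  The odd powers cancel on the left, and the
    remaining coefficients compare termwise by
    [leq_expn2_fact_double]. *)
Lemma expR_sym_le {R : realType} (x : R) :
  expR x + expR (- x) <= 2 * expR (x ^+ 2 / 2).
Proof.
have x2 : 0 <= x ^+ 2 / 2 :> R by rewrite divr_ge0// sqr_ge0.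
pose u := series (exp_coeff x) \+ series (exp_coeff (- x)).
have u_cvg : cvgn u by apply: is_cvgD; exact: is_cvg_series_exp_coeff.
rewrite [leLHS](_ : _ = limn u); last first.
  by rewrite limD//; exact: is_cvg_series_exp_coeff.
apply: limr_le => //; near=> N.
have : u N <= 2 * series (exp_coeff (x ^+ 2 / 2)) (uphalf N).
  elim: {+}N => [|k IH]; first by rewrite /u /= !seriesEnat/= !big_geq// mulr0 addr0.
  have -> : u k.+1 = u k + (1 + (-1) ^+ k) * exp_coeff x k.
    rewrite /u /= !seriesSr /exp_coeff/= [(- x) ^+ k]exprNn; ring.
  have -> : uphalf k.+1 = k./2.+1 by [].
  rewrite uphalf_half in IH.
  (* The term of index [k] of [u] vanishes for odd [k]; for [k = 2 m] it is
     compared with the term of index [m] on the right. *)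
  have [kodd|keven] := boolP (odd k).
    by rewrite -signr_odd kodd subrr mul0r addr0 (le_trans IH)// kodd.
  rewrite seriesSr mulrDr -signr_odd (negbTE keven) /= lerD//.
    by rewrite (le_trans IH)// (negbTE keven).
  rewrite /exp_coeff /= expr0 ler_pM2l//.
  have kE : k = (2 * k./2)%N by rewrite mul2n even_halfK.
  have -> : x ^+ k = (x ^+ 2) ^+ k./2 by rewrite -exprM -kE.
  rewrite [(_ / 2) ^+ _]exprMn -mulrA.
  apply: ler_wpM2l; first by rewrite exprn_ge0// sqr_ge0.
  rewrite exprVn -invfM lef_pV2 ?posrE ?mulr_gt0 ?exprn_gt0 ?ltr0n ?fact_gt0//.
  by rewrite -natrX -natrM ler_nat [in leqRHS]kE mul2n leq_expn2_fact_double.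
move=> /le_trans; apply; rewrite ler_pM2l//; exact: series_exp_coeff_le.
Unshelve. all: by end_near. Qed.

(** The constant is the best possible for given [l]: both sides agree at
    [x = q / l], where [expR (l x) / x ^ q] is minimal. *)
Lemma maxr0_exp_le {R : realType} (q : nat) (l x : R) : (0 < q)%N -> 0 < l ->
  Num.max x 0 ^+ q <= (q%:R / (l * expR 1)) ^+ q * expR (l * x).
Proof.
move=> q0 l0; have qR : 0 < q%:R :> R by rewrite ltr0n.
have [x0|x0] := leP x 0.
  by rewrite expr0n gtn_eqF// mulr_ge0 ?expR_ge0// exprn_ge0// divr_ge0 ?ler0n//
    mulr_ge0 ?expR_ge0 ?ltW.
have -> : l * x = q%:R * (l * x / q%:R) by field; rewrite gt_eqF.
rewrite expRM_natl -exprMn lerXn2r ?nnegrE//; first exact: ltW.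
  by rewrite mulr_ge0 ?expR_ge0// divr_ge0 ?ltW// mulr_gt0// expR_gt0.
have := expR_ge1Dx (l * x / q%:R - 1).
rewrite addrC subrK expRD expRN => h.
rewrite [leLHS](_ : _ = q%:R / l * (l * x / q%:R)); last first.
  by field; rewrite !gt_eqF.
rewrite [leRHS](_ : _ = q%:R / l * (expR (l * x / q%:R) / expR 1)).
  by rewrite ler_pM2l// divr_gt0.
by field; rewrite !gt_eqF// expR_gt0.
Qed.

(** The margin is small ([K = 0.93497...]), so [expR 2^-1] is needed to five
    digits: the degree 6 Taylor polynomial exceeds [704 / 427], and
    [s ^+ 2 - s] already exceeds [1000 / 935] at [s = 704 / 427]. *)
Lemma inv_expR_sub_sqrt_lt {R : realType} :
  (expR 1 - Num.sqrt (expR 1))^-1 < 935%:R / 1000%:R :> R.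
Proof.
have sE : Num.sqrt (expR 1) = expR 2^-1 :> R.
  rewrite (_ : expR 1 = expR 2^-1 ^+ 2) ?sqrtr_sqr ?ger0_norm ?expR_ge0//.
  by rewrite -expRM_natl; congr expR; field.
have eE : expR 1 = expR 2^-1 ^+ 2 :> R.
  by rewrite -expRM_natl; congr expR; field.
have : 704%:R / 427%:R <= expR 2^-1 :> R.
  have h0 : 0 <= 2^-1 :> R by rewrite invr_ge0.
  apply: le_trans (series_exp_coeff_le 7 h0).
  rewrite seriesEord/= !big_ord_recr big_ord0 /= /exp_coeff /=.
  rewrite !factS fact0 !exprS expr0. lra.
rewrite sE eE; move: (expR 2^-1) => s hs.
have h : 1000%:R / 935%:R < s ^+ 2 - s.
  (* [(s - c) (s + c - 1)] is [(s ^+ 2 - s) - (c ^+ 2 - c)]. *)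
  have : 0 <= (s - 704%:R / 427%:R) * (s + 704%:R / 427%:R - 1).
    by apply: mulr_ge0; lra.
  by lra.
rewrite -[ltRHS]invrK ltf_pV2 ?posrE; lra.
Qed.

(** * Averages over sign patterns *)

Definition sign_sum {R : realType} {n : nat} (a : 'I_n -> R)
    (e : {ffun 'I_n -> bool}) : R :=
  \sum_(i < n) a i * (-1) ^+ e i.

Definition sign_mean {R : realType} {n : nat}
    (c : {ffun 'I_n -> bool} -> R) : R :=
  \sum_e c e / 2 ^+ n.

Lemma le_sign_mean {R : realType} {n : nat} (c c' : {ffun 'I_n -> bool} -> R) :
  (forall e, c e <= c' e) -> sign_mean c <= sign_mean c'.
Proof.
by move=> cc'; apply: ler_sum => e _; rewrite ler_pM2r ?invr_gt0 ?exprn_gt0.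
Qed.

(** Flipping all signs permutes the sign patterns and negates the sum. *)
Lemma sign_meanN {R : realType} {n : nat} (a : 'I_n -> R) (g : R -> R) :
  sign_mean (fun e => g (- sign_sum a e)) =
  sign_mean (fun e => g (sign_sum a e)).
Proof.
pose flip (e : {ffun 'I_n -> bool}) := [ffun i => ~~ e i].
have flipK : involutive flip by move=> e; apply/ffunP => i; rewrite !ffunE negbK.
rewrite /sign_mean [RHS](reindex_inj (inv_inj flipK)).
apply: eq_bigr => e _; congr (g _ / _).
rewrite /sign_sum -sumrN; apply: eq_bigr => i _.
by rewrite ffunE signrN mulrN.
Qed.

(** Expanding the product of sums over each sign shows that the average is the
    product of the [cosh (l * a i)]; each factor is at most a Gaussian. *)
Lemma sign_mean_expR_le {R : realType} {n : nat} (a : 'I_n -> R) (l : R) :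
  sign_mean (fun e => expR (l * sign_sum a e)) <=
  expR (l ^+ 2 * (\sum_(i < n) a i ^+ 2) / 2).
Proof.
rewrite /sign_mean -big_distrl/= ler_pdivrMr ?exprn_gt0//.
have -> : \sum_e expR (l * sign_sum a e) =
    \prod_(i < n) \sum_(b : bool) expR (l * (a i * (-1) ^+ b)).
  rewrite bigA_distr_bigA/=; apply: eq_bigr => e _.
  by rewrite /sign_sum mulr_sumr expR_sum.
rewrite mulr_sumr mulr_suml expR_sum -[n in 2 ^+ n]card_ord -prodr_const -big_split.
apply: ler_prod => i _; rewrite big_bool /= expr0 expr1 mulr1 mulrN1 mulrN.
rewrite addr_ge0 ?expR_ge0//= addrC.
by rewrite (le_trans (expR_sym_le _))// exprMn mulrC.
Qed.

(** Any [l > 0] gives the upper bound [(q / (l e)) ^ q * expR (l ^ 2 S / 2)],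
    whose minimum over [l] is attained at [l ^ 2 = q / S]. *)
Lemma sign_mean_pos_part_le {R : realType} {n : nat} (a : 'I_n -> R) {q : nat} :
  (0 < q)%N ->
  sign_mean (fun e => Num.max (sign_sum a e) 0 ^+ q) <=
  Num.sqrt (q%:R * (\sum_(i < n) a i ^+ 2) / expR 1) ^+ q.
Proof.
move=> q0; set S := \sum_(i < n) _.
have S0 : 0 <= S by apply: sumr_ge0 => i _; exact: sqr_ge0.
have qR : 0 < q%:R :> R by rewrite ltr0n.
(* The optimal [l] is infinite when [S = 0], hence the separate case. *)
have [S_eq0|S_neq0] := eqVneq S 0.
  rewrite S_eq0 mulr0 mul0r sqrtr0 expr0n gtn_eqF//.
  have a0 i : a i = 0.
    apply/eqP; rewrite -sqrf_eq0.
    by move/eqP: S_eq0; rewrite psumr_eq0 => [/allP/(_ i (mem_index_enum i))|j _]//;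
      exact: sqr_ge0.
  rewrite /sign_mean big1// => e _.
  rewrite /sign_sum big1 => [|i _]; last by rewrite a0 mul0r.
  by rewrite maxxx expr0n gtn_eqF// mul0r.
have {S_neq0} Sgt0 : 0 < S by rewrite lt_neqAle eq_sym S_neq0.
pose l := Num.sqrt (q%:R / S).
have l0 : 0 < l by rewrite sqrtr_gt0 divr_gt0.
have lE : l ^+ 2 = q%:R / S by rewrite sqr_sqrtr// divr_ge0// ltW.
apply: (@le_trans _ _ (sign_mean (fun e =>
    (q%:R / (l * expR 1)) ^+ q * expR (l * sign_sum a e)))).
  by apply: le_sign_mean => e; exact: maxr0_exp_le.
rewrite /sign_mean.
under eq_bigr do rewrite -mulrA.
rewrite -mulr_sumr.
have c0 : 0 <= q%:R / (l * expR 1).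
  by rewrite divr_ge0 ?ler0n// mulr_ge0 ?expR_ge0// ltW.
apply: le_trans (ler_wpM2l (exprn_ge0 _ c0) (sign_mean_expR_le a l)) _.
rewrite -/S lE divfK ?gt_eqF// expRM_natl -exprMn.
have ce0 := mulr_ge0 c0 (expR_ge0 2^-1).
rewrite lerXn2r ?nnegrE ?sqrtr_ge0//.
(* For [l ^ 2 = q / S] the two bases are equal: compare their squares. *)
rewrite -(ger0_norm ce0) -sqrtr_sqr ler_wsqrtr//.
have half2 : expR 2^-1 ^+ 2 = expR 1 :> R by rewrite -expRM_natl mulfV.
rewrite exprMn half2 expr_div_n [(l * _) ^+ 2]exprMn lE.
rewrite le_eqVlt; apply/orP; left; apply/eqP.
by field; rewrite !gt_eqF ?expR_gt0.
Qed.

(** * From Rademacher variables to sign patterns *)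

(** The intersection over the full finite set is the form of event for which
    [independent_RVs] gives the probability. *)
Definition sign_cell {T : Type} {R : realType} {n : nat} (X : 'I_n -> T -> R)
    (e : {ffun 'I_n -> bool}) : set T :=
  \bigcap_(i in [set` [set: 'I_n]%SET]) X i @^-1` [set (-1) ^+ e i].

Lemma trivIset_sign_cell {T : Type} {R : realType} {n : nat}
  (X : 'I_n -> T -> R) (D : set {ffun 'I_n -> bool}) :
  trivIset D (sign_cell X).
Proof.
move=> e e' _ _ [w [we we']]; apply/ffunP => i; apply: (@signr_inj R).
have iT : [set` [set: 'I_n]%SET] i by rewrite /= inE.
by rewrite -(we i iT) -(we' i iT).
Qed.

Lemma measurable_sign_cell {d : measure_display} {T : measurableType d}
    {R : realType} {P : probability T R} {n : nat} (X : 'I_n -> {RV P >-> R})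
    (e : {ffun 'I_n -> bool}) : measurable (sign_cell X e).
Proof.
exact: fin_bigcap_measurable.
Qed.

Lemma probability_sign_cell {d : measure_display} {T : measurableType d}
    {R : realType} {P : probability T R} {n : nat} (X : 'I_n -> {RV P >-> R})
    (e : {ffun 'I_n -> bool}) :
  (forall i, rademacher P (X i)) -> independent_RVs P X ->
  P (sign_cell X e) = (2 ^- n)%:E.
Proof.
move=> X_rad X_ind.
rewrite /sign_cell (X_ind [set: 'I_n]%SET (fun i => [set (-1) ^+ e i]))//.
have half i : P (X i @^-1` [set (-1) ^+ e i]) = (2^-1)%:E.
  by case: (X_rad i); case: (e i).
under eq_bigr do rewrite half.
by rewrite prodEFin prodr_const cardsT card_ord exprVn.
Qed.

(** The sign cells are disjoint and their [2 ^ n] probabilities [2 ^- n] add up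
    to 1, so their complement is negligible and [f] is almost everywhere a
    simple function. *)
Lemma ge0_integral_sign_cells {d : measure_display} {T : measurableType d}
    {R : realType} {P : probability T R} {n : nat} (X : 'I_n -> {RV P >-> R})
    (f : T -> \bar R) (c : {ffun 'I_n -> bool} -> R) :
  (forall i, rademacher P (X i)) -> independent_RVs P X ->
  measurable_fun [set: T] f -> (forall w, 0 <= f w)%E ->
  (forall e w, sign_cell X e w -> f w = (c e)%:E) ->
  (\int[P]_w f w)%E = (sign_mean c)%:E.
Proof.
move=> X_rad X_ind mf f0 fc.
pose C := sign_cell X.
pose U := \big[setU/set0]_(e <- index_enum {ffun 'I_n -> bool}) C e.
have mC e : measurable (C e) by exact: measurable_sign_cell.
have PC e : P (C e) = (2 ^- n)%:E by exact: probability_sign_cell.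
have mU : measurable U by exact: bigsetU_measurable.
have intU (h : T -> \bar R) : measurable_fun [set: T] h -> (forall w, 0 <= h w)%E ->
    (\int[P]_(w in U) h w = \sum_e \int[P]_(w in C e) h w)%E.
  move=> mh h0; rewrite ge0_integral_bigsetU//.
  - exact: index_enum_uniq.
  - exact: trivIset_sign_cell.
  - exact: measurable_funTS.
have PU : P U = 1%E.
  rewrite -[LHS]mul1e -integral_cst// intU//.
  transitivity (\sum_(e : {ffun 'I_n -> bool}) (2 ^- n)%:E : \bar R)%E.
    by apply: eq_bigr => e _; rewrite integral_cst// mul1e; exact: PC.
  rewrite sumEFin sumr_const card_ffun card_bool card_ord -[RHS]/(1%R%:E).
  by rewrite -[(_ *+ (2 ^ n)%N)%R]mulr_natr natrX mulVf// expf_neq0.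
have PUC : P (~` U) = 0%E by rewrite probability_setC// PU subee.
rewrite (ge0_negligible_integral (N := ~` U))//; last exact: measurableC.
rewrite setTD setCK intU// /sign_mean -sumEFin; apply: eq_bigr => e _.
rewrite (eq_integral (cst (c e)%:E)); last first.
  by move=> w; rewrite inE => /fc.
by rewrite integral_cst// EFinM; congr (_ * _)%E; exact: PC.
Qed.

Lemma Lnorm_sign_sum {d : measure_display} {T : measurableType d}
    {R : realType} {P : probability T R} {n : nat} (a : 'I_n -> R)
    (X : 'I_n -> {RV P >-> R}) (g : R -> R) (q : nat) :
  (forall i, rademacher P (X i)) -> independent_RVs P X ->
  measurable_fun [set: R] g ->
  'N[P]_(q%:R%:E)[EFin \o (fun w => g (\sum_(i < n) a i * X i w)%R)]%E =
  (sign_mean (fun e => `|g (sign_sum a e)| ^+ q) `^ q%:R^-1)%:E.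
Proof.
move=> X_rad X_ind mg.
rewrite unlock -poweR_EFin; congr poweR.
apply: (ge0_integral_sign_cells X) => //.
- rewrite [X in measurable_fun _ X](_ : _ =
      EFin \o (fun w => `|g (\sum_(i < n) a i * X i w)| ^+ q)).
    apply: measurableT_comp => //; apply: measurable_funX.
    apply: measurableT_comp => //; apply: measurableT_comp => //.
    by apply: measurable_sum => i; exact: measurable_funM.
  by apply/funext => w /=; rewrite powR_mulrn.
- by move=> w; rewrite poweR_ge0.
- move=> e w ew; rewrite /= powR_mulrn//; congr (`|g _| ^+ q)%:E.
  apply: eq_bigr => i _; congr (_ * _).
  by apply: ew; rewrite /= inE.
Qed.

(** * Moment bounds *)

Lemma powR_inv_le {R : realType} (q : nat) (M b : R) :
  (0 < q)%N -> 0 <= M -> 0 <= b -> M <= b ^+ q -> M `^ q%:R^-1 <= b.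
Proof.
move=> q0 M0 b0 Mb.
have bE : (b ^+ q) `^ q%:R^-1 = b.
  by rewrite -powR_mulrn// -powRrM divff ?powRr1// pnatr_eq0 -lt0n.
by rewrite -[leRHS]bE ge0_ler_powR ?nnegrE ?invr_ge0 ?ler0n// exprn_ge0.
Qed.

Theorem theorem7 (R : realType) (d : measure_display) (T : measurableType d)
    (P : probability T R) (n : nat) (a : 'I_n -> R) (X : 'I_n -> {RV P >-> R})
    (a_ge0 : forall i, 0 <= a i)
    (X_rademacher : forall i, rademacher P (X i))
    (X_indep : independent_RVs P X) :
  let Z : T -> R := fun w => \sum_(i < n) a i * X i w in
  let K : R := (expR 1 - Num.sqrt (expR 1))^-1 in
  K < 935%:R / 1000%:R /\
  forall q : nat, (2 <= q)%N ->
    [/\ ('N[P]_(q%:R%:E)[EFin \o (Z^\+)%R] =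
          'N[P]_(q%:R%:E)[EFin \o (Z^\-)%R])%E,
        ('N[P]_(q%:R%:E)[EFin \o (Z^\-)%R] <=
          (Num.sqrt (2 * K * q%:R) * Num.sqrt (\sum_(i < n) a i ^+ 2))%R%:E)%E &
        ('N[P]_(q%:R%:E)[EFin \o Z] <=
          (2 `^ (q%:R^-1) * Num.sqrt (2 * K * q%:R) *
             Num.sqrt (\sum_(i < n) a i ^+ 2))%R%:E)%E].
Proof.
move=> Z K; split; first exact: inv_expR_sub_sqrt_lt.
move=> q q2; have q0 : (0 < q)%N by exact: ltnW.
set S := \sum_(i < n) _; set b := Num.sqrt (2 * K * q%:R) * Num.sqrt S.
have b0 : 0 <= b by rewrite mulr_ge0// sqrtr_ge0.
have S0 : 0 <= S by apply: sumr_ge0 => i _; exact: sqr_ge0.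
have K0 : (expR 1)^-1 <= 2 * K.
  have lt_sqrt : Num.sqrt (expR 1) < expR 1 :> R.
    rewrite -[ltRHS]sqr_sqrtr ?expR_ge0// expr2 ltr_pMl ?sqrtr_gt0 ?expR_gt0//.
    by rewrite -sqrtr1 ltr_sqrt ?expR_gt1 ?ltr01 ?expR_gt0.
  have : (expR 1)^-1 <= K.
    rewrite lef_pV2 ?posrE ?expR_gt0 ?subr_gt0//.
    by rewrite lerBlDr lerDl sqrtr_ge0.
  have : 0 <= K by rewrite invr_ge0 subr_ge0 ltW.
  lra.
pose M (g : R -> R) := sign_mean (fun e => g (sign_sum a e)).
have M_ge0 g : (forall x, 0 <= g x) -> 0 <= M g.
  by move=> g0; apply: sumr_ge0 => e _; rewrite divr_ge0// exprn_ge0.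
pose pos q (x : R) := Num.max x 0 ^+ q.
pose neg q (x : R) := Num.max (- x) 0 ^+ q.
have Mneg : M (neg q) = M (pos q) by exact: (sign_meanN a (pos q)).
have Mpos_le : M (pos q) <= b ^+ q.
  apply: (le_trans (sign_mean_pos_part_le a q0)).
  rewrite lerXn2r ?nnegrE ?sqrtr_ge0//.
  rewrite /b -sqrtrM ?ler_wsqrtr//.
    by rewrite -/S mulrC mulrA ler_wpM2r// ler_wpM2r.
  by rewrite mulr_ge0// (le_trans _ K0)// invr_ge0 expR_ge0.
have normpos : ('N[P]_(q%:R%:E)[EFin \o (Z^\+)%R] = (M (pos q) `^ q%:R^-1)%:E)%E.
  rewrite (Lnorm_sign_sum a X (fun x => Num.max x 0))//; last first.
    exact: measurable_maxr.
  congr ((_ `^ _)%:E); apply: eq_bigr => e _.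
  by rewrite ger0_norm// le_max lexx orbT.
have normneg : ('N[P]_(q%:R%:E)[EFin \o (Z^\-)%R] = (M (neg q) `^ q%:R^-1)%:E)%E.
  rewrite (Lnorm_sign_sum a X (fun x => Num.max (- x) 0))//; last first.
    exact: measurable_maxr.
  congr ((_ `^ _)%:E); apply: eq_bigr => e _.
  by rewrite ger0_norm// le_max lexx orbT.
have pos_ge0 x : 0 <= pos q x by rewrite exprn_ge0// le_max lexx orbT.
have neg_ge0 x : 0 <= neg q x by rewrite exprn_ge0// le_max lexx orbT.
split.
- by rewrite normpos normneg Mneg.
- rewrite normneg Mneg lee_fin; apply: powR_inv_le => //.
  exact: M_ge0.
- rewrite (Lnorm_sign_sum a X id)// lee_fin -mulrA -/b.
  have c0 : 0 <= 2 `^ q%:R^-1 :> R by exact: powR_ge0.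
  apply: powR_inv_le => //; first 2 [exact: mulr_ge0].
    exact: (M_ge0 (fun x => `|x| ^+ q)).
  rewrite exprMn -[in leRHS]powR_mulrn// -powRrM mulVf ?pnatr_eq0 -?lt0n//.
  rewrite powRr1// mulr_natl mulr2n.
  apply: (@le_trans _ _ (M (pos q) + M (neg q))); last by rewrite Mneg lerD.
  rewrite -big_split/=; apply: ler_sum => e _; rewrite -mulrDl.
  rewrite ler_pM2r ?invr_gt0 ?exprn_gt0//.
  case: (leP 0 (sign_sum a e)) => x0.
    rewrite ger0_norm// -[leLHS]addr0 lerD//.
    by rewrite /pos (max_idPl x0).
  rewrite ltr0_norm// -[leLHS]add0r lerD//.
  by rewrite /neg (max_idPl _)// oppr_ge0 ltW.
Qed.
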